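(* For $n\geq 5$, let $f_n^1(\sigma)$ be the number of permutations $\pi\in\mathcal{S}_n$ with $\theta(\pi)=\pi$ that avoid $\sigma$. Then $f_n^1(\sigma)=F_{n+1}$ for $\sigma\in\{231,312,321\}$, $f_n^1(\sigma)=2$ for $\sigma\in\{132,213\}$, and $f_n^1(123)=0$.
   Context: $\mathcal{S}_n$ is the symmetric group on $[n]$, permutations in one-line notation $\pi_1\cdots\pi_n$. A permutation avoids a pattern $\tau$ if it has no subsequence order-isomorphic to $\tau$. The standard cycle notation of $\pi$ writes each cycle (fixed points included) with its largest element first and orders cycles by increasing largest element. The fundamental bijection $\theta:\mathcal{S}_n\to\mathcal{S}_n$ maps $\pi$ to the permutation whose one-line notation is obtained by erasing the parentheses of the standard cycle notation of $\pi$. Fibonacci numbers: $F_0=0$, $F_1=F_2=1$, $F_m=F_{m-1}+F_{m-2}$. *)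

(* Defs.v *)
From mathcomp Require Import all_boot all_fingroup.

Set Implicit Arguments.
Unset Strict Implicit.
Unset Printing Implicit Defensive.

(* Permutations of [n] are modelled as 'S_n, acting on 'I_n = {0, ..., n-1};
   shifting all values by one changes neither pattern containment nor the
   standard cycle notation. *)

Definition one_line (n : nat) (s : 'S_n) : seq 'I_n :=
  [seq s i | i <- enum 'I_n].

Definition cycle_max (n : nat) (s : 'S_n) (x : 'I_n) : bool :=
  [forall y in porbit s x, y <= x].

Definition cycle_from (n : nat) (s : 'S_n) (x : 'I_n) : seq 'I_n :=
  traject s x #|porbit s x|.

(* enum 'I_n is increasing, so the cycles come by increasing largest element;
   fixed points give cycles of length one. *)
Definition std_cycles (n : nat) (s : 'S_n) : seq (seq 'I_n) :=
  [seq cycle_from s x | x <- enum 'I_n & cycle_max s x].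

Definition theta_word (n : nat) (s : 'S_n) : seq 'I_n := flatten (std_cycles s).

Lemma mem_cycle_from (n : nat) (s : 'S_n) x y :
  (y \in cycle_from s x) = (y \in porbit s x).
Proof. by rewrite porbit_traject. Qed.

Lemma uniq_theta_word (n : nat) (s : 'S_n) : uniq (theta_word s).
Proof.
rewrite /theta_word /std_cycles.
have: uniq [seq x <- enum 'I_n | cycle_max s x] by rewrite filter_uniq ?enum_uniq.
have: all (cycle_max s) [seq x <- enum 'I_n | cycle_max s x] by exact: filter_all.
elim: [seq x <- _ | _] => //= x r IHr /andP[mx mr] /andP[xr ur].
rewrite cat_uniq uniq_traject_porbit IHr // andbT /=.
apply/hasPn => z /flatten_mapP[y ry]; rewrite mem_cycle_from => zy.
apply/negP => /=; rewrite mem_cycle_from => zx.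
have eq_xy : porbit s x = porbit s y.
  by move: zx zy; rewrite -!eq_porbit_mem => /eqP <- /eqP <-.
have my := allP mr _ ry.
suff exy : x = y by rewrite exy ry in xr.
apply/val_inj/eqP; rewrite /= eqn_leq.
move/forall_inP: mx => mx; move/forall_inP: my => my.
by rewrite my ?mx // ?eq_xy ?porbit_id // -eq_xy porbit_id.
Qed.

Lemma mem_theta_word (n : nat) (s : 'S_n) x : x \in theta_word s.
Proof.
have [y xy ymax] := @arg_maxnP _ x (fun y => y \in porbit s x) val (porbit_id s x).
have eq_xy : porbit s y = porbit s x by apply/eqP; rewrite eq_porbit_mem.
apply/flatten_mapP; exists y; last by rewrite mem_cycle_from eq_xy porbit_id.
rewrite mem_filter mem_enum andbT; apply/forall_inP => z.
by rewrite eq_xy => /ymax.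
Qed.

Lemma size_theta_word (n : nat) (s : 'S_n) : size (theta_word s) = n.
Proof.
rewrite -(card_uniqP (uniq_theta_word s)) -[RHS]card_ord.
by apply: eq_card => x; rewrite mem_theta_word.
Qed.

Lemma theta_inj (n : nat) (s : 'S_n) :
  injective (fun i : 'I_n => nth i (theta_word s) i).
Proof.
move=> i j; rewrite (set_nth_default j) ?size_theta_word // => /eqP.
by rewrite nth_uniq ?size_theta_word ?uniq_theta_word // => /eqP/val_inj.
Qed.

Definition theta (n : nat) (s : 'S_n) : 'S_n := perm (@theta_inj n s).

Lemma one_line_theta (n : nat) (s : 'S_n) : one_line (theta s) = theta_word s.
Proof.
have sz : size (one_line (theta s)) = n by rewrite size_map size_enum_ord.
case: n s sz => [|n] s sz.
  by rewrite (size0nil sz) (size0nil (size_theta_word s)).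
apply: (@eq_from_nth _ ord0) => [|i]; rewrite sz ?size_theta_word // => ltin.
rewrite (nth_map ord0) ?size_enum_ord // permE nth_enum_ord //.
by apply: set_nth_default; rewrite size_theta_word.
Qed.

Definition order_iso (u v : seq nat) : bool :=
  (size u == size v) &&
  [forall i : 'I_(size u), forall j : 'I_(size u),
     (nth 0 u i < nth 0 u j) == (nth 0 v i < nth 0 v j)].

(* The subsequences of a word of length n are its masks by n-bit vectors. *)
Definition contains (n : nat) (s : 'S_n) (tau : seq nat) : bool :=
  [exists m : n.-tuple bool,
     order_iso (mask m [seq val x | x <- one_line s]) tau].

Definition avoids (n : nat) (s : 'S_n) (tau : seq nat) : bool :=
  ~~ contains s tau.

Lemma containsP (n : nat) (s : 'S_n) (tau : seq nat) :
  reflect (exists2 u, subseq u [seq val x | x <- one_line s] & order_iso u tau)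
          (contains s tau).
Proof.
apply: (iffP existsP) => [[m mP]|[u /subseqP[m szm ->] uP]].
  by eexists; last exact: mP; exact: mask_subseq.
have szmn : size m == n by rewrite szm 2!size_map size_enum_ord.
by exists (Tuple szmn).
Qed.

Definition fixed_avoiders (n : nat) (tau : seq nat) : nat :=
  #|[set s : 'S_n | (theta s == s) && avoids s tau]|.

Fixpoint fib (m : nat) : nat :=
  match m with
  | 0 => 0
  | 1 => 1
  | (k.+1 as k').+1 => fib k' + fib k
  end.

(* Main.v *)
Require Import Defs.
From mathcomp Require Import all_boot all_fingroup.
From mathcomp Require Import zify.

(** The word of theta s lists, for each cycle maximum x, the cycle
    x, s x, s^2 x, ... .  Applying s^-1 to every letter shows that theta s = s
    iff the cycles, written s^-1 x, x, s x, ..., concatenate to 0, 1, ..., n-1.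
    As s x <= x, no such cycle has a third entry: the fixed points of theta are
    the involutions moving every point by at most one, i.e. the direct sums of
    blocks 1 and 21, and splitting off the first block gives the Fibonacci
    recurrence.  Inversions of a direct sum of blocks 1 and 21 sit in adjacent
    positions, so 231, 312 and 321 never occur; a block 21 preceded (resp.
    followed) by another block creates 132 (resp. 213), which leaves only the
    identity and one transposition; and positions 0, 2, 4 always carry 123. *)

Set Implicit Arguments.
Unset Strict Implicit.
Unset Printing Implicit Defensive.

Lemma infix_flatten (T : eqType) (u : seq T) (us : seq (seq T)) :
  u \in us -> infix u (flatten us).
Proof. by case/path.splitPr => us1 us2; rewrite flatten_cat infix_infix. Qed.

Lemma infix_iota (u : seq nat) (m n : nat) :
  infix u (iota m n) -> exists p, u = iota p (size u).
Proof.
rewrite infixE drop_iota take_iota => /eqP <-.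
by eexists; rewrite size_iota.
Qed.

Lemma pairwise_flatten (T : Type) (r : rel T) (us : seq (seq T)) :
  pairwise r (flatten us) = all (pairwise r) us && pairwise (allrel r) us.
Proof.
have allrel_flatten u vs : allrel r u (flatten vs) = all (allrel r u) vs.
  by elim: vs => [|v vs IHvs] /=; rewrite ?allrel0r // allrel_catr IHvs.
elim: us => //= u us IHus; rewrite pairwise_cat allrel_flatten IHus.
by rewrite andbCA -!andbA; congr (_ && _); rewrite andbCA.
Qed.

Lemma forall_ord_recl (n : nat) (P : pred 'I_n.+1) :
  [forall i, P i] = P ord0 && [forall i, P (lift ord0 i)].
Proof.
apply/forallP/andP => [P_all | [P0 /forallP P_lift] i].
  by split=> //; apply/forallP.
by case: (unliftP ord0 i) => [j|] ->.
Qed.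

Lemma sorted_val_enum_ord (n : nat) : sorted ltn [seq val i | i <- enum 'I_n].
Proof. by rewrite val_enum_ord iota_ltn_sorted. Qed.

Lemma sorted_ord_eq (n : nat) (u v : seq 'I_n) :
  sorted ltn [seq val i | i <- u] -> sorted ltn [seq val i | i <- v] ->
  u =i v -> u = v.
Proof.
move=> su sv uv; apply: (inj_map val_inj).
by apply: (irr_sorted_eq ltn_trans ltnn su sv); apply: eq_mem_map.
Qed.

Lemma subseq_enum_ord (n : nat) (u : seq 'I_n) :
  subseq u (enum 'I_n) = sorted ltn [seq val i | i <- u].
Proof.
apply/idP/idP => [/(map_subseq val)/subseq_sorted|su].
  by apply=> //; [exact: ltn_trans | exact: sorted_val_enum_ord].
suff -> : u = [seq i <- enum 'I_n | i \in u] by exact: filter_subseq.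
apply: sorted_ord_eq => // [|i]; last by rewrite mem_filter mem_enum andbT.
apply: (subseq_sorted ltn_trans _ (sorted_val_enum_ord n)).
exact/map_subseq/filter_subseq.
Qed.

Lemma porbit_involutive (T : finType) (s : {perm T}) (x : T) :
  s (s x) = x -> porbit s x = [set x; s x].
Proof.
move=> ssx; apply/setP => y; rewrite !inE; apply/porbitP/orP => [[k ->]|].
  elim: k => [|k]; first by left; rewrite expg0 perm1.
  by rewrite expgSr permM => -[] /eqP ->; [right | left; rewrite ssx].
by case=> /eqP ->; [exists 0; rewrite expg0 perm1 | exists 1; rewrite expg1].
Qed.

(** * Fixed points of theta *)

Lemma one_line_inj (n : nat) : injective (@one_line n).
Proof.
by move=> s t /eq_in_map st; apply/permP => i; apply: st; rewrite mem_enum.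
Qed.

Lemma theta_fixed_word_enum (n : nat) (s : 'S_n) :
  (theta s == s) = ([seq s^-1%g x | x <- theta_word s] == enum 'I_n).
Proof.
rewrite -(inj_eq (@one_line_inj n)) one_line_theta.
by rewrite -[LHS](inj_eq (inj_map (@perm_inj _ s^-1%g))) (mapK (permK s)).
Qed.

Lemma ex_cycle_max (n : nat) (s : 'S_n) (i : 'I_n) :
  exists2 x, cycle_max s x & i \in porbit s x.
Proof.
have /flatten_mapP[x] := mem_theta_word s i.
by rewrite mem_filter mem_cycle_from => /andP[mx _]; exists x.
Qed.

Lemma leq_cycle_max (n : nat) (s : 'S_n) (x : 'I_n) : cycle_max s x -> s x <= x.
Proof. by move/forall_inP; apply; exact: (mem_porbit s 1). Qed.

Definition near_involution (n : nat) (s : 'S_n) : bool :=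
  [forall i, [&& s (s i) == i, s i <= i.+1 & i <= (s i).+1]].

Lemma near_involutionP (n : nat) (s : 'S_n) :
  reflect (forall i, [/\ s (s i) = i, s i <= i.+1 & i <= (s i).+1])
          (near_involution s).
Proof.
apply: (iffP forallP) => s_near i; first by have /and3P[/eqP] := s_near i.
by have [-> -> ->] := s_near i; rewrite eqxx.
Qed.

Lemma theta_fixed_cycle_iota (n : nat) (s : 'S_n) (x : 'I_n) :
  theta s = s -> cycle_max s x ->
  exists p, [seq val (s^-1%g y) | y <- cycle_from s x] = iota p #|porbit s x|.
Proof.
move=> /eqP; rewrite theta_fixed_word_enum => /eqP s_fixed x_max.
have /infix_flatten/infixP[u [v uv]] : cycle_from s x \in std_cycles s.
  by rewrite map_f // mem_filter x_max mem_enum.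
rewrite -[#|_|](size_traject s x) -(size_map (fun y => val (s^-1%g y))).
apply: (@infix_iota _ 0 n).
rewrite -val_enum_ord -s_fixed -map_comp /theta_word uv !map_cat.
exact: infix_infix.
Qed.

Lemma theta_fixed_near_involution (n : nat) (s : 'S_n) :
  theta s = s -> near_involution s.
Proof.
move=> s_fixed; apply/near_involutionP => i.
have [x x_max i_x] := ex_cycle_max s i.
have [ssx x_near] : s (s x) = x /\ x <= (s x).+1.
  have [p] := theta_fixed_cycle_iota s_fixed x_max; rewrite /cycle_from.
  have := iter_porbit s x; have := card_porbit_neq0 s x.
  case: #|_| => [//|[|[|k]]] /= _.
  - by move=> sx _; rewrite !sx.
  - by move=> ssx; rewrite -{1}ssx !permK => -[-> ->].
  - move=> _; rewrite !permK => -[_ x_p sx_p].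
    by have := leq_cycle_max x_max; lia.
have sx_le := leq_cycle_max x_max.
by move: i_x; rewrite porbit_involutive // !inE => /orP[]/eqP ->;
  rewrite !ssx; split => //; lia.
Qed.

Lemma near_involution_cycle (n : nat) (s : 'S_n) (x : 'I_n) :
  near_involution s -> cycle_max s x ->
  [seq val (s^-1%g y) | y <- cycle_from s x] =
    if s x == x then [:: val x] else [:: val (s x); val x].
Proof.
move=> /near_involutionP s_near x_max; have [ssx _ _] := s_near x.
rewrite /cycle_from porbit_involutive // cards2 (eq_sym x).
have sVx : s^-1%g x = s x by rewrite -{1}ssx permK.
by case: eqP => [sx|_] /=; rewrite ?permK sVx ?sx.
Qed.

Lemma near_involution_cycle_ltn (n : nat) (s : 'S_n) (x y : 'I_n) :
  near_involution s -> cycle_max s x -> cycle_max s y -> x < y ->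
  allrel ltn [seq val (s^-1%g z) | z <- cycle_from s x]
             [seq val (s^-1%g z) | z <- cycle_from s y].
Proof.
move=> s_near x_max y_max xy; rewrite !near_involution_cycle //.
have sx_le := leq_cycle_max x_max; have sy_le := leq_cycle_max y_max.
have [ssy _ y_sy] := near_involutionP _ s_near y.
have sy_x : s y != x :> nat.
  by apply/eqP => /val_inj sy; rewrite -sy ssy sy in sx_le; lia.
by case: ifP; case: ifP; rewrite /allrel /=; lia.
Qed.

Lemma near_involution_theta_fixed (n : nat) (s : 'S_n) :
  near_involution s -> theta s = s.
Proof.
move=> s_near; apply/eqP.
rewrite theta_fixed_word_enum; apply/eqP/sorted_ord_eq.
- rewrite -map_comp map_flatten -map_comp (sorted_pairwise ltn_trans).
  rewrite pairwise_flatten all_map pairwise_map; apply/andP; split.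
    apply/allP => x; rewrite mem_filter => /andP[x_max _] /=.
    rewrite near_involution_cycle //; case: eqP => //= /eqP sx.
    by rewrite ltn_neqAle sx leq_cycle_max.
  apply: (@sub_in_pairwise _ _ (relpre val ltn)) (filter_all (cycle_max s) _) _.
    by move=> x y; exact: near_involution_cycle_ltn.
  apply: subseq_pairwise (filter_subseq _ _) _.
  by rewrite -pairwise_map -(sorted_pairwise ltn_trans) sorted_val_enum_ord.
- exact: sorted_val_enum_ord.
- by move=> i; rewrite mem_enum -[i](permK s) map_f ?mem_theta_word.
Qed.

Lemma theta_fixedE (n : nat) (s : 'S_n) : (theta s == s) = near_involution s.
Proof.
apply/eqP/idP; first exact: theta_fixed_near_involution.
exact: near_involution_theta_fixed.
Qed.

(** * Enumeration of near-involutions *)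

(* The direct sums 1 (+) s and 21 (+) s. *)
Definition dsum1 (n : nat) (s : 'S_n) : 'S_n.+1 := lift_perm ord0 ord0 s.

Definition dsum21 (n : nat) (s : 'S_n) : 'S_n.+2 :=
  (tperm ord0 (lift ord0 ord0) * dsum1 (dsum1 s))%g.

Lemma dsum1_inj (n : nat) : injective (@dsum1 n).
Proof.
move=> s t st; apply/permP => i; apply: (@lift_inj _ ord0).
by rewrite -!(lift_perm_lift ord0) -/(dsum1 s) st.
Qed.

Lemma dsum21_inj (n : nat) : injective (@dsum21 n).
Proof. by move=> s t /mulgI/dsum1_inj/dsum1_inj. Qed.

Lemma dsum21_0 (n : nat) (s : 'S_n) : dsum21 s ord0 = lift ord0 ord0.
Proof. by rewrite permM tpermL lift_perm_lift lift_perm_id. Qed.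

Lemma dsum21_1 (n : nat) (s : 'S_n) : dsum21 s (lift ord0 ord0) = ord0.
Proof. by rewrite permM tpermR lift_perm_id. Qed.

Lemma dsum21_lift (n : nat) (s : 'S_n) (i : 'I_n) :
  dsum21 s (lift ord0 (lift ord0 i)) = lift ord0 (lift ord0 (s i)).
Proof. by rewrite permM tpermD // !lift_perm_lift. Qed.

(* Surjectivity by counting: dsum1 is injective, and the permutations fixing
   ord0, being those supported on its complement, are n! in number. *)
Lemma dsum1P (n : nat) (t : 'S_n.+1) :
  reflect (exists s, t = dsum1 s) (t ord0 == ord0).
Proof.
apply: (iffP eqP) => [|[s ->]]; last exact: lift_perm_id.
suff dsum1_onto : [set dsum1 s | s : 'S_n] = [set t : 'S_n.+1 | t ord0 == ord0].
  move=> t0; have /imsetP[s _ ->] : t \in [set dsum1 s | s : 'S_n].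
    by rewrite dsum1_onto inE t0.
  by exists s.
apply/eqP; rewrite eqEcard (card_imset _ (@dsum1_inj n)) card_Sn.
have <- : #|perm_on [set~ (ord0 : 'I_n.+1)]| = n`!.
  by rewrite card_perm cardsC1 card_ord.
apply/andP; split.
  by apply/subsetP => _ /imsetP[s _ ->]; rewrite inE lift_perm_id.
apply/subset_leq_card/subsetP => u; rewrite inE => /eqP u0.
by apply/subsetP => i; rewrite !inE; apply: contra => /eqP ->; rewrite u0.
Qed.

Lemma dsum21P (n : nat) (t : 'S_n.+2) :
  reflect (exists s, t = dsum21 s)
          ((t ord0 == lift ord0 ord0) && (t (lift ord0 ord0) == ord0)).
Proof.
apply: (iffP andP) => [[/eqP t0 /eqP t1]|[s ->]]; last first.
  by rewrite dsum21_0 dsum21_1.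
have [u tu] : exists u, (tperm ord0 (lift ord0 ord0) * t)%g = dsum1 u.
  by apply/dsum1P; rewrite permM tpermL t1.
have [s us] : exists s, u = dsum1 s.
  apply/dsum1P/eqP/(@lift_inj _ ord0).
  by rewrite -(lift_perm_lift ord0) -/(dsum1 u) -tu permM tpermR.
by exists s; rewrite /dsum21 -us -tu mulgA tperm2 mul1g.
Qed.

Lemma near_involution_dsum1 (n : nat) (s : 'S_n) :
  near_involution (dsum1 s) = near_involution s.
Proof.
rewrite /near_involution forall_ord_recl !lift_perm_id eqxx /=.
apply: eq_forallb => i; rewrite !lift_perm_lift (inj_eq lift_inj).
by rewrite !lift0 !ltnS.
Qed.

Lemma near_involution_dsum21 (n : nat) (s : 'S_n) :
  near_involution (dsum21 s) = near_involution s.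
Proof.
rewrite /near_involution !forall_ord_recl !(dsum21_0, dsum21_1) !eqxx /=.
apply: eq_forallb => i; rewrite !dsum21_lift !(inj_eq lift_inj).
by rewrite !lift0 !ltnS.
Qed.

Lemma near_involution_dsumU (n : nat) :
  [set s : 'S_n.+2 | near_involution s] =
    [set dsum1 s | s : 'S_n.+1 & near_involution s] :|:
    [set dsum21 s | s : 'S_n & near_involution s].
Proof.
apply/setP => s; rewrite !inE; apply/idP/orP; last first.
  case=> /imsetP[t]; rewrite inE => t_near ->;
  by rewrite ?near_involution_dsum1 ?near_involution_dsum21.
move=> s_near; have [ss0 s0_le _] := near_involutionP _ s_near ord0.
have [/dsum1P[t st]|s0] := boolP (s ord0 == ord0).
  by left; rewrite st imset_f // inE -near_involution_dsum1 -st.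
have s01 : s ord0 = lift ord0 ord0.
  by apply: ord_inj; rewrite lift0; move: s0 s0_le; rewrite -val_eqE /=; lia.
have /dsum21P[t st] :
  (s ord0 == lift ord0 ord0) && (s (lift ord0 ord0) == ord0).
  by rewrite -{2}s01 ss0 s01 !eqxx.
by right; rewrite st imset_f // inE -near_involution_dsum21 -st.
Qed.

Lemma near_involution1 (n : nat) : near_involution (1%g : 'S_n).
Proof. by apply/near_involutionP => i; rewrite !perm1; split => //; lia. Qed.

Lemma card_near_involution (n : nat) :
  #|[set s : 'S_n | near_involution s]| = fib n.+1.
Proof.
have card_le1 m : m <= 1 -> #|[set s : 'S_m | near_involution s]| = 1.
  move=> m_le1; rewrite -[RHS](cards1 (1%g : 'S_m)); apply: eq_card => s.
  rewrite !inE (@perm_on_id _ s setT) ?cardsT ?card_ord //.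
    by rewrite near_involution1 eqxx.
  exact/subsetP.
elim/ltn_ind: n => -[|[|n]] IHn; [exact: card_le1|exact: card_le1|].
rewrite near_involution_dsumU cardsU.
rewrite (card_imset _ (@dsum1_inj _)) (card_imset _ (@dsum21_inj _)) !IHn //.
rewrite disjoint_setI0 ?cards0 ?subn0 //.
apply/pred0P => s /=; apply/negP => /andP[/imsetP[t _ ->] /imsetP[u _]].
by move/permP/(_ ord0); rewrite dsum21_0 lift_perm_id.
Qed.

(** * Pattern avoidance *)

Lemma order_iso3 (x y z a b c : nat) :
  order_iso [:: x; y; z] [:: a; b; c] =
  [&& (x < y) == (a < b), (x < z) == (a < c), (y < z) == (b < c),
      (y < x) == (b < a), (z < x) == (c < a) & (z < y) == (c < b)].
Proof.
rewrite /order_iso /= !forall_ord_recl /=.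
have forall_ord0 (P : pred 'I_0) : [forall i, P i] = true.
  by apply/forallP => -[].
rewrite !forall_ord0 /= !ltnn !eqxx /= !andbT /bump /=.
lia.
Qed.

Lemma contains3P (n : nat) (s : 'S_n) (a b c : nat) :
  reflect (exists i j k : 'I_n,
             i < j < k /\
             order_iso [:: val (s i); val (s j); val (s k)] [:: a; b; c])
          (contains s [:: a; b; c]).
Proof.
apply: (iffP (containsP s _)); last first.
  case=> i [j [k [/andP[ij jk] iso]]].
  exists [:: val (s i); val (s j); val (s k)] => //.
  apply: (map_subseq val (s1 := [:: s i; s j; s k])).
  apply: (map_subseq s (s1 := [:: i; j; k])).
  by rewrite subseq_enum_ord /= ij jk.
case=> _ /subseqP[m _ ->]; rewrite /one_line -2!map_mask.
have := mask_subseq m (enum 'I_n); rewrite subseq_enum_ord.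
case: (mask m _) => [|i [|j [|k [|? ?]]]] // lt_ijk iso.
by exists i, j, k; rewrite -[i < j < k]andbT -andbA.
Qed.

Definition excedances (n : nat) (s : 'S_n) : {set 'I_n} :=
  [set i : 'I_n | i < s i].

Lemma near_involution_ltn (n : nat) (s : 'S_n) (i j : 'I_n) :
  near_involution s -> i.+1 < j -> s i < s j.
Proof.
move=> /near_involutionP s_near ij.
have [_ si_le _] := s_near i; have [_ _ sj_ge] := s_near j.
have s_ij : s i <> s j :> nat.
  by move/val_inj/perm_inj => eq_ij; rewrite eq_ij in ij; lia.
lia.
Qed.

Lemma near_involution_inversion (n : nat) (s : 'S_n) (i j : 'I_n) :
  near_involution s -> i < j -> s j < s i -> s i = j.
Proof.
move=> s_near ij inv; apply: val_inj => /=.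
have [_ si_le _] := near_involutionP _ s_near i.
have [_ _ sj_ge] := near_involutionP _ s_near j.
lia.
Qed.

Lemma near_involution_avoids_last_lt_first (n : nat) (s : 'S_n) (a b c : nat) :
  near_involution s -> c < a -> avoids s [:: a; b; c].
Proof.
move=> s_near ca; apply/contains3P => -[i [j [k [/andP[ij jk]]]]].
have := near_involution_ltn s_near (leq_ltn_trans ij jk).
rewrite order_iso3 ca => ik /and5P[_ _ _ _ /andP[/eqP ki _]].
by have := ltn_trans ik ki; rewrite ltnn.
Qed.

Lemma near_involution_avoids_132_excedances (n : nat) (s : 'S_n) (a : 'I_n) :
  a = 0 :> nat -> near_involution s ->
  avoids s [:: 1; 3; 2] = (excedances s \subset [set a]).
Proof.
move=> a0 s_near; apply: negb_inj; rewrite negbK.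
apply/contains3P/subsetPn => [[i [j [k [/andP[ij jk]]]]]|[i]].
  rewrite order_iso3 => /and5P[_ _ _ _ /andP[_ /eqP inv]].
  have sj := near_involution_inversion s_near jk inv.
  by exists j; rewrite !inE ?sj // -val_eqE /= a0; lia.
rewrite !inE -val_eqE /= a0 => i_exc i_gt0.
have [ssi _ _] := near_involutionP _ s_near i.
have sa_i : s a < s (s i) by apply: near_involution_ltn => //; lia.
by rewrite ssi in sa_i; exists a, i, (s i); rewrite order_iso3 ssi; split; lia.
Qed.

Lemma near_involution_avoids_213_excedances (n : nat) (s : 'S_n) (a : 'I_n) :
  a.+2 = n -> near_involution s ->
  avoids s [:: 2; 1; 3] = (excedances s \subset [set a]).
Proof.
move=> an s_near; apply: negb_inj; rewrite negbK.
apply/contains3P/subsetPn => [[i [j [k [/andP[ij jk]]]]]|[i]].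
  rewrite order_iso3 => /and5P[_ _ _ /eqP inv _].
  have si := near_involution_inversion s_near ij inv.
  by exists i; rewrite !inE ?si // -val_eqE /=; have := ltn_ord k; lia.
rewrite !inE -val_eqE /= => i_exc i_a.
have [ssi si_le _] := near_involutionP _ s_near i.
have lt_i2n : i.+2 < n by have := ltn_ord (s i); lia.
have s_i2 : s i < s (Ordinal lt_i2n) by exact: near_involution_ltn.
by exists i, (s i), (Ordinal lt_i2n); rewrite order_iso3 ssi /=; split; lia.
Qed.

Lemma near_involution_contains_123 (n : nat) (s : 'S_n) :
  5 <= n -> near_involution s -> contains s [:: 1; 2; 3].
Proof.
move=> n_ge5 s_near; have [lt0n lt2n] : 0 < n /\ 2 < n by lia.
apply/contains3P; exists (Ordinal lt0n), (Ordinal lt2n), (Ordinal n_ge5).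
have s02 : s (Ordinal lt0n) < s (Ordinal lt2n) by exact: near_involution_ltn.
have s24 : s (Ordinal lt2n) < s (Ordinal n_ge5) by exact: near_involution_ltn.
by split=> //; rewrite order_iso3 /=; lia.
Qed.

Lemma near_involution_tperm (n : nat) (a b : 'I_n) :
  b = a.+1 :> nat -> near_involution (tperm a b).
Proof.
move=> ab; apply/near_involutionP => i; rewrite tpermK.
by case: tpermP => [->|->|_ _]; split=> //; lia.
Qed.

Lemma excedances1 (n : nat) : excedances (1%g : 'S_n) = set0.
Proof. by apply/setP => i; rewrite !inE perm1 ltnn. Qed.

Lemma excedances_tperm (n : nat) (a b : 'I_n) :
  a < b -> excedances (tperm a b) = [set a].
Proof.
move=> ab; apply/setP => i; rewrite !inE.
case: tpermP => [->|->|/eqP/negPf-> _]; rewrite ?eqxx ?ltnn //.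
by rewrite -val_eqE /=; lia.
Qed.

Lemma near_involution_perm_on (n : nat) (s : 'S_n) (a b : 'I_n) :
  b = a.+1 :> nat -> near_involution s -> excedances s \subset [set a] ->
  perm_on [set a; b] s.
Proof.
move=> ab /near_involutionP s_near /subsetP exc_s.
have exc_a (i : 'I_n) : i < s i -> i = a.
  by move=> i_exc; apply/set1P/exc_s; rewrite inE.
apply/subsetP => i; rewrite !inE; have [ssi _ i_le] := s_near i.
case: (ltngtP (s i) i) => [si_lt _|/exc_a-> _|/val_inj-> /eqP//].
  have sia : s i = a by apply: exc_a; rewrite ssi.
  by rewrite -!val_eqE /=; rewrite sia in si_lt i_le; lia.
by rewrite eqxx.
Qed.

(* The identity and the transposition are two such permutations, and there are
   only 2! permutations supported on {a, a + 1}. *)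
Lemma card_near_involution_excedance1 (n : nat) (a : 'I_n) :
  a.+1 < n ->
  #|[set s : 'S_n | near_involution s & excedances s \subset [set a]]| = 2.
Proof.
move=> lt_a1n; pose b := Ordinal lt_a1n.
have ab : a != b by rewrite -val_eqE /=; lia.
apply/eqP; rewrite eqn_leq; apply/andP; split.
  have <- : #|perm_on [set a; b]| = 2 by rewrite card_perm cards2 ab.
  apply/subset_leq_card/subsetP => s; rewrite inE => /andP[s_near s_exc].
  exact: near_involution_perm_on.
have <- : #|[set 1%g; tperm a b]| = 2.
  rewrite cards2 eq_sym; case: eqP => // /permP/(_ a).
  by rewrite perm1 tpermL => ba; rewrite ba eqxx in ab.
apply/subset_leq_card/subsetP => s; rewrite !inE => /orP[]/eqP ->.
  by rewrite near_involution1 excedances1 sub0set.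
by rewrite near_involution_tperm // excedances_tperm /=.
Qed.

Lemma fixed_avoidersE (n : nat) (tau : seq nat) :
  fixed_avoiders n tau = #|[set s : 'S_n | near_involution s & avoids s tau]|.
Proof. by apply: eq_card => s; rewrite !inE theta_fixedE. Qed.

Lemma fixed_avoiders_last_lt_first (n a b c : nat) :
  c < a -> fixed_avoiders n [:: a; b; c] = fib n.+1.
Proof.
move=> ca; rewrite fixed_avoidersE -card_near_involution; apply: eq_card => s.
rewrite !inE; apply: andb_idr => s_near.
exact: near_involution_avoids_last_lt_first.
Qed.

Lemma fixed_avoiders_excedance1 (n : nat) (a : 'I_n) (tau : seq nat) :
  a.+1 < n ->
  (forall s : 'S_n, near_involution s ->
     avoids s tau = (excedances s \subset [set a])) ->
  fixed_avoiders n tau = 2.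
Proof.
move=> lt_a1n avoidsE; rewrite fixed_avoidersE.
rewrite -(card_near_involution_excedance1 lt_a1n); apply: eq_card => s.
by rewrite !inE; apply: andb_id2l => /avoidsE.
Qed.

Lemma fixed_avoiders_132 (n : nat) : 1 < n -> fixed_avoiders n [:: 1; 3; 2] = 2.
Proof.
move=> n_gt1.
apply: (@fixed_avoiders_excedance1 n (Ordinal (ltnW n_gt1))) => // s.
exact: near_involution_avoids_132_excedances.
Qed.

Lemma fixed_avoiders_213 (n : nat) : 1 < n -> fixed_avoiders n [:: 2; 1; 3] = 2.
Proof.
case: n => [|[|n]] // _.
apply: (@fixed_avoiders_excedance1 n.+2 (inord n)) => [|s].
  by rewrite inordK.
by apply: near_involution_avoids_213_excedances; rewrite inordK.
Qed.

Lemma fixed_avoiders_123 (n : nat) :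
  5 <= n -> fixed_avoiders n [:: 1; 2; 3] = 0.
Proof.
move=> n_ge5; rewrite fixed_avoidersE; apply: eq_card0 => s; rewrite !inE.
by apply/negP => /andP[s_near]; rewrite /avoids near_involution_contains_123.
Qed.

Theorem theorem5p1 (n : nat) (hn : 5 <= n) :
  [/\ forall sigma : seq nat,
        sigma \in [:: [:: 2; 3; 1]; [:: 3; 1; 2]; [:: 3; 2; 1]] ->
        fixed_avoiders n sigma = fib n.+1,
      forall sigma : seq nat,
        sigma \in [:: [:: 1; 3; 2]; [:: 2; 1; 3]] ->
        fixed_avoiders n sigma = 2
    & fixed_avoiders n [:: 1; 2; 3] = 0].
Proof.
have n_gt1 : 1 < n by exact: leq_trans hn.
split; last exact: fixed_avoiders_123.
- move=> sigma; rewrite !inE => /or3P[] /eqP ->;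
    exact: fixed_avoiders_last_lt_first.
- move=> sigma; rewrite !inE => /orP[] /eqP ->; first exact: fixed_avoiders_132.
  exact: fixed_avoiders_213.
Qed.
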